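(* Let $0<c<a\le b<n$ be integers. There exists a latin square of order $n$ containing two subsquares, of orders $a$ and $b$ respectively, whose intersection is a subsquare of order $c$, if and only if \[ n-2b\ge a-2c\ge 0 \] and \[ (n-2a)(n-2b)\ge c^2-(n-2a-2b+3c)^2. \]
   Context: A latin square of order $n$ is an $n\times n$ matrix on $n$ symbols in which each symbol occurs exactly once in each row and each column. A subsquare of a latin square $L$ is a submatrix of $L$ (obtained by selecting some set of rows and some set of columns, not necessarily contiguous) that is itself a latin square; its order is its number of rows. The intersection of two subsquares is the set of cells lying in both. *)

(* Defs.v *)
From mathcomp Require Import all_boot all_order all_algebra.
Set Implicit Arguments.
Unset Strict Implicit.
Unset Printing Implicit Defensive.

(* The symbol set [Y] is existentially quantified, so that the same predicate
   applies to a submatrix, which uses only some of the symbols of [S]. *)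
Definition latin_square (n : nat) (S : finType) (M : 'M[S]_n) : Prop :=
  exists Y : {set S},
    [/\ #|Y| = n,
        forall i j, M i j \in Y,
        forall i y, y \in Y -> #|[set j | M i j == y]| = 1
      & forall j y, y \in Y -> #|[set i | M i j == y]| = 1].

(* [A] is the set of cells of the subsquare; [f] and [g] enumerate the selected
   rows and columns. They are not required to be increasing, since reordering
   rows or columns does not affect being a latin square. *)
Definition subsquare (n : nat) (S : finType) (L : 'M[S]_n) (k : nat)
    (A : {set 'I_n * 'I_n}) : Prop :=
  exists f g : 'I_k -> 'I_n,
    [/\ injective f, injective g,
        A = setX [set f i | i : 'I_k] [set g j | j : 'I_k]
      & latin_square (mxsub f g L)].

(* Main.v *)
Require Import Defs.
From mathcomp Require Import all_boot all_order all_algebra.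
From mathcomp Require Import zify.
Set Implicit Arguments.
Unset Strict Implicit.
Unset Printing Implicit Defensive.
Import Order.TTheory GRing.Theory Num.Theory.
Local Open Scope ring_scope.

(* A row, column or symbol falls into one of four classes, according to its
   membership in the two subsquares [A] and [B]; write [p0 = c], [p1 = a - c],
   [p2 = b - c], [p3 = n - a - b + c] for the class sizes.  The subsquare
   conditions force, for every triple of classes, the number of cells with that
   row, column and symbol class; the three inequalities say that these numbers
   are nonnegative.  Conversely, by Hilton's amalgamation theorem, nonnegative
   numbers with the right marginals come from a latin square: split the rows,
   then the columns, then the symbols into single ones.  Each splitting step
   removes from a bipartite multigraph with degrees [p * q j], [p * r k] a
   subgraph with degrees [q j], [r k], which exists by integrality of flows. *)

(** * Integral flows in bipartite multigraphs *)

Section Transport.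
Local Open Scope nat_scope.
Variables (J K : finType) (X : J -> K -> nat) (q : J -> nat) (r : K -> nat).

Definition subtransport (y : J -> K -> nat) : Prop :=
  [/\ forall j k, y j k <= X j k,
      forall j, \sum_k y j k <= q j
    & forall k, \sum_j y j k <= r k].

(** Residual graph with the rows contracted: an arc means that some row can move one unit from
    column [k] to column [k']. *)
Definition residual (y : J -> K -> nat) : rel K :=
  fun k k' => [exists j, (0 < y j k) && (y j k' < X j k')].

Lemma sum_delta_row (j j0 : J) (k0 : K) :
  \sum_k ((j == j0) && (k == k0) : nat) = (j == j0).
Proof.
rewrite (bigD1 k0) //= eqxx andbT big1 ?addn0 // => k /negPf ->.
by rewrite andbF.
Qed.

Lemma sum_delta_col (k k0 : K) (j0 : J) :
  \sum_j ((j == j0) && (k == k0) : nat) = (k == k0).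
Proof.
rewrite (bigD1 j0) //= eqxx big1 ?addn0 // => j /negPf ->.
by [].
Qed.

(* Pushing one unit along the first step moves the deficiency from row [j0] to
   row [j1] and changes only column [k0], which a simple path never revisits. *)
Lemma augment_path (s : seq K) (y : J -> K -> nat) (j0 : J) (k0 : K) :
  subtransport y -> \sum_k y j0 k < q j0 -> y j0 k0 < X j0 k0 ->
  path (residual y) k0 s -> uniq (k0 :: s) ->
  \sum_j y j (last k0 s) < r (last k0 s) ->
  exists2 y', subtransport y'
    & \sum_j \sum_k y' j k = (\sum_j \sum_k y j k).+1.
Proof.
elim: s y j0 k0 => [|k1 s IHs] y j0 k0 [yX yq yr] ltq ltX.
  move=> _ _ /= ltr.
  pose y' j k := y j k + ((j == j0) && (k == k0)).
  have rowE j : \sum_k y' j k = \sum_k y j k + (j == j0).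
    by rewrite big_split /= sum_delta_row.
  exists y'; first split.
  - move=> j k; rewrite /y'.
    by case: eqP => [->|_] /=; [case: eqP => [->|_]|]; rewrite ?addn0 ?addn1.
  - by move=> j; rewrite rowE; case: eqP => [->|_]; rewrite ?addn0 ?addn1.
  - move=> k; rewrite big_split /= sum_delta_col.
    by case: eqP => [->|_]; rewrite ?addn0 ?addn1.
  under eq_bigr => j _ do rewrite rowE.
  rewrite big_split /= -addn1; congr (_ + _).
  by rewrite (bigD1 j0) //= eqxx big1 // => j /negPf ->.
move=> /= /andP[/existsP[j1 /andP[y1 ltX1]] pth] /andP[k0s us] ltr.
pose y' j k := y j k + ((j == j0) && (k == k0)) - ((j == j1) && (k == k0)).
(* The truncated subtraction in [y'] is exact because [y j1 k0] is positive. *)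
have y'E j k : y' j k + ((j == j1) && (k == k0))
             = y j k + ((j == j0) && (k == k0)).
  rewrite /y' subnK //; case: eqP => [->|//]; case: eqP => [->|//] /=.
  by rewrite (leq_trans y1) ?leq_addr.
have rowE j : \sum_k y' j k + (j == j1) = \sum_k y j k + (j == j0).
  rewrite -{1}(sum_delta_row j j1 k0) -(sum_delta_row j j0 k0) -!big_split /=.
  by apply: eq_bigr => k _; rewrite y'E.
have colE k : \sum_j y' j k = \sum_j y j k.
  apply/eqP; rewrite -(eqn_add2r (k == k0)); apply/eqP.
  rewrite -{1}(sum_delta_col k k0 j1) -(sum_delta_col k k0 j0) -!big_split /=.
  by apply: eq_bigr => j _; rewrite y'E.
have y'_off j k : k != k0 -> y' j k = y j k.
  by move=> /negPf kk0; rewrite /y' kk0 !andbF addn0 subn0.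
have k10 : k1 != k0 by apply: contraNneq k0s => ->; rewrite inE eqxx.
have k0s' : k0 \notin s by apply: contraNN k0s => ks; rewrite inE ks orbT.
have tot : \sum_j \sum_k y' j k = \sum_j \sum_k y j k.
  by rewrite exchange_big /= [RHS]exchange_big; apply: eq_bigr => k _.
have sub' : subtransport y'.
  split.
  - move=> j k; have := y'E j k; have := yX j k.
    case: (j =P j0) => [->|_] /=; [case: (k =P k0) => [->|_]|] => /=; lia.
  - move=> j; have := rowE j; have := yq j.
    by case: (j =P j0) => [->|_]; lia.
  - by move=> k; rewrite colE.
rewrite -tot; apply: (IHs y' j1 k1) => //.
- have := rowE j1; have := yq j1; rewrite eqxx.
  by case: (j1 =P j0) => [->|_]; lia.
- by rewrite y'_off.
- have offs k : k \in k1 :: s -> k != k0.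
    by rewrite inE => /orP[/eqP -> //|ks]; apply: contraNneq k0s' => <-.
  rewrite -(@eq_in_path _ (mem (k1 :: s)) (residual y) (residual y')) //.
    move=> k k' ks k's; apply: eq_existsb => j.
    by rewrite !y'_off ?offs.
  by apply/allP.
- by rewrite colE.
Qed.

(** Max-flow min-cut: from a deficient row, either the residual graph reaches a deficient column,
    giving an augmenting path, or the reachable part is a cut that contradicts the marginals. *)
Lemma augment (p : nat) (y : J -> K -> nat) :
  0 < p ->
  (forall j, \sum_k X j k = p * q j) -> (forall k, \sum_j X j k = p * r k) ->
  subtransport y -> \sum_j \sum_k y j k < \sum_j q j ->
  exists2 y', subtransport y'
    & \sum_j \sum_k y' j k = (\sum_j \sum_k y j k).+1.
Proof.
move=> p0 Xq Xr suby lty; have [yX yq yr] := suby.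
have [j0 ltq] : exists j0, \sum_k y j0 k < q j0.
  apply/existsP; apply: contraTT lty; rewrite negb_exists => /forallP H.
  by rewrite -leqNgt; apply: leq_sum => j _; rewrite leqNgt.
pose T := [set k | [exists k0, (y j0 k0 < X j0 k0) && connect (residual y) k0 k]].
case: (boolP [exists k in T, \sum_j y j k < r k]) => [/exists_inP[k]|].
  rewrite inE => /existsP[k0 /andP[ltX /connectP[s0 pth0 ->]]].
  case: (shortenP pth0) => s pth us _ ltr.
  exact: (augment_path suby ltq ltX pth us ltr).
rewrite negb_exists => /forallP satT.
have {satT} satT k : k \in T -> \sum_j y j k = r k.
  move=> kT; apply/eqP; rewrite eqn_leq yr /= leqNgt.
  by have := satT k; rewrite kT.
(* No deficient column is reachable, so the reachable rows [S] and columns [T]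
   form a cut, too small to be compatible with the marginals of [X]. *)
pose S := [set j | (j == j0) || [exists k in T, 0 < y j k]].
have full j k : j \in S -> k \notin T -> y j k = X j k.
  rewrite inE => jS kT; apply/eqP; rewrite eqn_leq yX /= leqNgt.
  apply: contraNN kT => lt; rewrite inE; case/orP: jS => [/eqP e|].
    by apply/existsP; exists k; rewrite -e lt connect0.
  case/exists_inP=> k1; rewrite inE => /existsP[k0 /andP[lt0 c0]] y1.
  apply/existsP; exists k0; rewrite lt0 (connect_trans c0) // connect1 //.
  by apply/existsP; exists j; rewrite y1.
have empty j k : j \notin S -> k \in T -> y j k = 0.
  rewrite inE negb_or => /andP[_ jS] kT; apply/eqP; rewrite -leqn0 leqNgt.
  by apply: contraNN jS => lt; apply/exists_inP; exists k.
have rT : \sum_(k in T) r k = \sum_(j in S) \sum_(k in T) y j k.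
  rewrite exchange_big; apply: eq_bigr => k kT.
  rewrite -(satT k kT) [LHS](bigID (mem S)) /= [X in _ + X]big1 ?addn0 // => j jS.
  exact: empty.
pose XST' := \sum_(j in S) \sum_(k | k \notin T) X j k.
have lt : \sum_(k in T) r k + XST' < \sum_(j in S) q j.
  rewrite rT -big_split /=.
  have -> : \sum_(j in S) (\sum_(k in T) y j k + \sum_(k | k \notin T) X j k)
          = \sum_(j in S) \sum_k y j k.
    apply: eq_bigr => j jS; rewrite [RHS](bigID (mem T)) /=; congr (_ + _).
    by apply: eq_bigr => k kT; rewrite full.
  have j0S : j0 \in S by rewrite inE eqxx.
  rewrite (bigD1 j0) //= [X in _ < X](bigD1 j0) //= -addSn leq_add //.
  by apply: leq_sum => j _; apply: yq.
have le : p * \sum_(j in S) q j <= p * \sum_(k in T) r k + XST'.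
  rewrite !big_distrr /=.
  under eq_bigr => j _ do rewrite -Xq (bigID (mem T)) /=.
  rewrite big_split leq_add2r exchange_big /=.
  apply: leq_sum => k kT; rewrite -Xr [X in _ <= X](bigID (mem S)) /=.
  exact: leq_addr.
(* Multiplying [lt] by [p] and comparing with [le] yields [p * (XST' + 1) <= XST'], impossible for
   positive [p]. *)
by exfalso; move: lt le; rewrite -/XST'; move: XST' => x; nia.
Qed.

(** Augmenting the zero matrix one unit at a time reaches the total of [q], which is also that of
    [r]; sums bounded termwise with equal totals are then equal termwise. *)
Lemma transport_extract (p : nat) :
  0 < p ->
  (forall j, \sum_k X j k = p * q j) -> (forall k, \sum_j X j k = p * r k) ->
  exists y : J -> K -> nat,
    [/\ forall j k, y j k <= X j k,
        forall j, \sum_k y j k = q j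
      & forall k, \sum_j y j k = r k].
Proof.
move=> p0 Xq Xr.
have eqr : \sum_j q j = \sum_k r k.
  apply/eqP; rewrite -(eqn_pmul2l p0) !big_distrr /=; apply/eqP.
  under eq_bigr => j _ do rewrite -Xq.
  by rewrite exchange_big; apply: eq_bigr => k _; rewrite Xr.
have [y [yX yq yr] tot] : exists2 y, subtransport y
    & \sum_j \sum_k y j k = \sum_j q j.
  suff /(_ _ (leqnn _)) : forall m, m <= \sum_j q j ->
      exists2 y, subtransport y & \sum_j \sum_k y j k = m by [].
  elim=> [_|m IHm ltm].
    exists (fun _ _ => 0); first by split=> *; rewrite ?big1.
    by rewrite big1 // => j _; rewrite big1.
  have [y suby toty] := IHm (ltnW ltm).
  by rewrite -toty in ltm *; apply: augment p0 Xq Xr suby ltm.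
exists y; split=> //.
  move=> j; apply/eqP.
  have [_] := leqif_sum (fun j (_ : xpredT j) => leqif_eq (yq j)).
  by rewrite tot eqxx => /esym/forallP/(_ j).
move=> k; apply/eqP.
have [_] := leqif_sum (fun k (_ : xpredT k) => leqif_eq (yr k)).
by rewrite exchange_big /= tot eqr eqxx => /esym/forallP/(_ k).
Qed.

End Transport.

(** * Splitting classes into single rows, columns and symbols *)

Section Amalgamation.
Local Open Scope nat_scope.

(** Extracting one layer leaves marginals with one factor less, so induction on [s] peels off all of
    [X]. *)
Lemma transport_decompose (J K N : finType) (q : J -> nat) (r : K -> nat)
    (s : seq N) (X : J -> K -> nat) :
  uniq s ->
  (forall j, \sum_k X j k = size s * q j) ->
  (forall k, \sum_j X j k = size s * r k) ->
  exists Y : N -> J -> K -> nat,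
    [/\ forall j k, \sum_(m <- s) Y m j k = X j k,
        forall m j, m \in s -> \sum_k Y m j k = q j
      & forall m k, m \in s -> \sum_j Y m j k = r k].
Proof.
elim: s X => [|m0 s IHs] X /=.
  move=> _ Xq _; exists (fun _ _ _ => 0); split=> // j k; rewrite big_nil.
  by apply/esym/eqP; have := Xq j; move/eqP; rewrite sum_nat_eq0 => /forallP/(_ k).
case/andP=> m0s us Xq Xr.
have [y [yX yq yr]] := transport_extract (ltn0Sn _) Xq Xr.
have X'E j k : X j k - y j k + y j k = X j k by rewrite subnK.
have [|j|k|Y [YX Yq Yr]] := IHs (fun j k => X j k - y j k) => //.
- have: \sum_k (X j k - y j k + y j k) = (size s).+1 * q j.
    by under eq_bigr => k _ do rewrite X'E.
  by rewrite big_split /= yq; lia.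
- have: \sum_j (X j k - y j k + y j k) = (size s).+1 * r k.
    by under eq_bigr => j _ do rewrite X'E.
  by rewrite big_split /= yr; lia.
have neq m : m \in s -> (m == m0) = false.
  by move=> ms; apply/negbTE; apply: contraNneq m0s => <-.
exists (fun m => if m == m0 then y else Y m); split.
- move=> j k; rewrite big_cons eqxx -[RHS]X'E addnC -YX; congr (_ + _).
  by rewrite !big_seq; apply: eq_bigr => m ms; rewrite neq.
- by move=> m j; rewrite inE; case: eqP => [_ _|_ /= ms]; [apply: yq|apply: Yq].
- by move=> m k; rewrite inE; case: eqP => [_ _|_ /= ms]; [apply: yr|apply: Yr].
Qed.

Lemma split_classes (I J K N : finType) (t : N -> I) (q : J -> nat)
    (r : K -> nat) (x : I -> J -> K -> nat) :
  (forall i j, \sum_k x i j k = #|[pred m | t m == i]| * q j) ->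
  (forall i k, \sum_j x i j k = #|[pred m | t m == i]| * r k) ->
  exists x' : N -> J -> K -> nat,
    [/\ forall i j k, \sum_(m | t m == i) x' m j k = x i j k,
        forall m j, \sum_k x' m j k = q j
      & forall m k, \sum_j x' m j k = r k].
Proof.
move=> xq xr.
have /fin_all_exists[Y HY] i : exists Y : N -> J -> K -> nat,
    [/\ forall j k, \sum_(m | t m == i) Y m j k = x i j k,
        forall m j, t m == i -> \sum_k Y m j k = q j
      & forall m k, t m == i -> \sum_j Y m j k = r k].
  have [||| Y [Yx Yq Yr]] := @transport_decompose J K N q r
      (enum [pred m | t m == i]) (x i); first exact: enum_uniq.
  - by move=> j; rewrite -cardE.
  - by move=> k; rewrite -cardE.
  exists Y; split=> [j k|m j mi|m k mi].
  - by rewrite -Yx big_enum.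
  - by apply: Yq; rewrite mem_enum.
  - by apply: Yr; rewrite mem_enum.
exists (fun m => Y (t m) m); split=> [i j k|m j|m k].
- have [<- _ _] := HY i; by apply: eq_bigr => m /eqP ->.
- by have [_ H _] := HY (t m); apply: H.
- by have [_ _ H] := HY (t m); apply: H.
Qed.

Lemma sum_classes (I N : finType) (t : N -> I) (F : N -> nat) :
  \sum_m F m = \sum_i \sum_(m | t m == i) F m.
Proof. by rewrite (partition_big t xpredT). Qed.

(* [x i j k] is the prescribed number of cells with row class [i], column class
   [j] and symbol class [k]; [x3 s m l] below is the indicator of [L m l = s]. *)
Lemma amalgamation (I N : finType) (t : N -> I) (x : I -> I -> I -> nat)
    (p := fun i => #|[pred m | t m == i]|) :
  (forall i j, \sum_k x i j k = p i * p j) ->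
  (forall i k, \sum_j x i j k = p i * p k) ->
  (forall j k, \sum_i x i j k = p j * p k) ->
  exists L : N -> N -> N,
    [/\ forall m, injective (L m), forall l, injective (L^~ l)
      & forall m l, 0 < x (t m) (t l) (t (L m l))].
Proof.
move=> xk xj xi.
have [x1 [x1x x1k x1j]] := split_classes xk xj.
(* The rows are now single, so they have weight 1 when the columns are split; symbol classes keep
   weight [p]. *)
have [||x2 [x2x x2k x2m]] := @split_classes I N I N t (fun=> 1) p
    (fun j m k => x1 m j k).
- by move=> j m; rewrite muln1 x1k.
- by move=> j k; rewrite (sum_classes t) -xi; apply: eq_bigr => i _; rewrite x1x.
have x2l m k : \sum_l x2 l m k = p k.
  by rewrite (sum_classes t) -(x1j m k); apply: eq_bigr => j _; rewrite x2x.
have [||x3 [x3x x3l x3m]] := @split_classes I N N N t (fun=> 1) (fun=> 1)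
    (fun k m l => x2 l m k).
- by move=> k m; rewrite muln1 x2l.
- by move=> k l; rewrite muln1 x2m.
have x3s m l : \sum_s x3 s m l = 1.
  by rewrite (sum_classes t) -(x2k l m); apply: eq_bigr => k _; rewrite x3x.
have /fin_all_exists[L HL] m : exists f : N -> N, forall l, 0 < x3 (f l) m l.
  have /fin_all_exists[f Hf] l : exists s, 0 < x3 s m l.
    apply/existsP; rewrite -[X in is_true X]negbK negb_exists.
    apply/negP => /forallP H.
    have := x3s m l; rewrite big1 // => s _; have := H s; lia.
  by exists f.
(* Every line of [x3] has sum 1, hence a unique positive entry; this makes [L] injective in each row
   and column. *)
have one (F : N -> nat) u v : \sum_s F s = 1 -> 0 < F u -> 0 < F v -> u = v.
  move=> F1 Fu Fv; apply/eqP; apply: contraTT (leqnn 1) => uv.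
  rewrite -ltnNge -{2}F1 (bigD1 u) //= (bigD1 v) 1?eq_sym //=; lia.
exists L; split.
- move=> m l l' e; apply: (one _ _ _ (x3l (L m l) m)) => //.
  by rewrite e.
- move=> l m m' e; apply: (one _ _ _ (x3m (L m l) l)) => //.
  by rewrite e.
(* Undoing the splittings, the class count is a sum that contains the positive term
   [x3 (L m l) m l]. *)
move=> m l; rewrite -x1x (bigD1 m) //= -x2x (bigD1 l) //= -x3x.
rewrite (bigD1 (L m l)) //=; have := HL m l; lia.
Qed.

End Amalgamation.

(** * Latin squares and subsquares through injectivity *)

Section LatinSquares.
Local Open Scope nat_scope.

Lemma latin_square_inj (n : nat) (L : 'M['I_n]_n) :
  latin_square L ->
  (forall i, injective (L i)) /\ (forall j, injective (L^~ j)).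
Proof.
case=> Y [_ LY row col]; split.
- move=> i j j' e; have /eqP/cards1P[j0 E] := row i _ (LY i j).
  have: j \in [set j0] by rewrite -E inE.
  have: j' \in [set j0] by rewrite -E inE e.
  by rewrite !inE => /eqP -> /eqP ->.
- move=> j i i' e; have /eqP/cards1P[i0 E] := col j _ (LY i j).
  have: i \in [set i0] by rewrite -E inE.
  have: i' \in [set i0] by rewrite -E inE e.
  by rewrite !inE => /eqP -> /eqP ->.
Qed.

Lemma card_fiber_inj (k : nat) (S : finType) (Y : {set S}) (h : 'I_k -> S) y :
  injective h -> #|Y| = k -> (forall i, h i \in Y) -> y \in Y ->
  #|[set i | h i == y]| = 1.
Proof.
move=> hI cY hY yY.
have imY : h @: 'I_k = Y.
  apply/eqP; rewrite eqEcard card_imset // card_ord cY leqnn andbT.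
  by apply/subsetP => _ /imsetP[i _ ->].
move: yY; rewrite -imY => /imsetP[i _ ->].
rewrite (_ : [set _ | _] = [set i]) ?cards1 //.
by apply/setP => i'; rewrite !inE (inj_eq hI).
Qed.

Lemma latin_squareI (k : nat) (S : finType) (M : 'M[S]_k) (Y : {set S}) :
  #|Y| = k -> (forall i j, M i j \in Y) ->
  (forall i, injective (M i)) -> (forall j, injective (M^~ j)) ->
  latin_square M.
Proof.
move=> cY MY rI cI; exists Y; split=> // [i|j] y yY.
- exact: (card_fiber_inj (rI i) cY).
- exact: (@card_fiber_inj _ _ _ (M^~ j) y (cI j) cY).
Qed.

Lemma enum_set_inj (T : finType) (A : {set T}) (k : nat) :
  #|A| = k ->
  exists2 f : 'I_k -> T, injective f & [set f i | i : 'I_k] = A.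
Proof.
move=> cA; pose f (i : 'I_k) := enum_val (cast_ord (esym cA) i).
have fI : injective f by move=> i j /enum_val_inj /cast_ord_inj.
exists f => //; apply/eqP; rewrite eqEcard; apply/andP; split.
  by apply/subsetP => _ /imsetP[i _ ->]; apply: enum_valP.
by rewrite (card_imset _ fI) card_ord cA.
Qed.

Lemma subsquareI (n k : nat) (L : 'M['I_n]_n) (R C Y : {set 'I_n}) :
  (forall i, injective (L i)) -> (forall j, injective (L^~ j)) ->
  #|R| = k -> #|C| = k -> #|Y| = k ->
  (forall i j, i \in R -> j \in C -> L i j \in Y) ->
  subsquare L k (setX R C).
Proof.
move=> rI cI cR cC cY LY.
have [f fI fR] := enum_set_inj cR; have [g gI gC] := enum_set_inj cC.
exists f, g; rewrite fR gC; split=> //.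
apply: (latin_squareI cY) => [i j|i j j'|j i i'].
- by rewrite mxE LY // -?fR -?gC imset_f.
- by rewrite !mxE => /rI/gI.
- by rewrite !mxE => /cI/fI.
Qed.

(** A row of the subsquare already shows every symbol of [Y] within the columns [C], and no symbol
    repeats in a row of [L]; the same holds for columns. *)
Lemma subsquareE (n k : nat) (L : 'M['I_n]_n) (A : {set 'I_n * 'I_n}) :
  latin_square L -> subsquare L k A ->
  exists R C Y : {set 'I_n},
    [/\ A = setX R C, [/\ #|R| = k, #|C| = k & #|Y| = k],
        forall i j, i \in R -> (L i j \in Y) = (j \in C)
      & forall i j, j \in C -> (L i j \in Y) = (i \in R)].
Proof.
move=> /latin_square_inj[rI cI] [f [g [fI gI -> [Y [cY LY row col]]]]].
exists [set f i | i : 'I_k], [set g j | j : 'I_k], Y; split=> //.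
- by split=> //; rewrite card_imset ?card_ord.
- move=> _ j /imsetP[i _ ->]; apply/idP/imsetP => [yY|[j' _ ->]].
    have /eqP/cards1P[j' E] := row i _ yY.
    have: j' \in [set j'] by rewrite inE.
    by rewrite -E inE mxE => /eqP/rI <-; exists j'.
  by have := LY i j'; rewrite mxE.
- move=> i _ /imsetP[j _ ->]; apply/idP/imsetP => [yY|[i' _ ->]].
    have /eqP/cards1P[i' E] := col j _ yY.
    have: i' \in [set i'] by rewrite inE.
    by rewrite -E inE mxE => /eqP/cI <-; exists i'.
  by have := LY i' j; rewrite mxE.
Qed.

Lemma setX_injective (T1 T2 : finType) (A1 B1 : {set T1}) (A2 B2 : {set T2}) :
  0 < #|B1| -> 0 < #|B2| -> setX A1 A2 = setX B1 B2 -> A1 = B1 /\ A2 = B2.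
Proof.
move=> /card_gt0P[u uB] /card_gt0P[v vB] /setP E.
have := E (u, v); rewrite !in_setX /= uB vB => /andP[uA vA].
split; apply/setP=> z.
- by have := E (z, v); rewrite !in_setX /= vA vB !andbT.
- by have := E (u, z); rewrite !in_setX /= uA uB.
Qed.

(** A cell is determined by its row and symbol, and every such pair occurs. *)
Lemma card_row_symbol (n : nat) (L : 'I_n -> 'I_n -> 'I_n) (R S : {set 'I_n}) :
  (forall i, injective (L i)) ->
  #|[set u : 'I_n * 'I_n | (u.1 \in R) && (L u.1 u.2 \in S)]| = #|R| * #|S|.
Proof.
move=> LI; rewrite -cardsX.
have hI : injective (fun u : 'I_n * 'I_n => (u.1, L u.1 u.2)).
  by move=> [i j] [i' j'] /= [<- /LI <-].
rewrite -(card_imset _ hI) /=; apply: eq_card => -[i s]; rewrite in_setX /=.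
apply/imsetP/andP => [[[i' j]]|[iR sS]].
  by rewrite inE /= => /andP[iR sS] [-> ->].
exists (i, invF (LI i) s); rewrite ?inE /= ?f_invF ?iR //.
Qed.

End LatinSquares.

(** * Counting arguments for the three inequalities *)

Section Necessity.
Local Open Scope nat_scope.

Lemma card_preim_inj (T : finType) (h : T -> T) (S : {set T}) :
  injective h -> #|[set x | h x \in S]| = #|S|.
Proof. by move=> hI; apply: on_card_preimset; apply/onW_bij/injF_bij. Qed.

Lemma setIX (T1 T2 : finType) (A1 B1 : {set T1}) (A2 B2 : {set T2}) :
  setX A1 A2 :&: setX B1 B2 = setX (A1 :&: B1) (A2 :&: B2).
Proof. by apply/setP => -[u v]; rewrite !inE /= andbACA. Qed.

Lemma subsquares_bounds (n a b c : nat) (L : 'M['I_n]_n)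
    (A B : {set 'I_n * 'I_n}) :
  0 < c -> c < a ->
  latin_square L -> subsquare L a A -> subsquare L b B ->
  subsquare L c (A :&: B) ->
  exists p1 p2 p3 : nat,
    [/\ [/\ a = c + p1, b = c + p2 & n = c + p1 + p2 + p3],
        c <= p1, p2 <= p3
      & p3 * (c + p1 + p2) <= p3 * p3 + 2 * (p1 * p2)].
Proof.
move=> c0 ca latL subA subB subC.
have [rI cI] := latin_square_inj latL.
have [RA [CA [YA [eA [rA kA yA] AR AC]]]] := subsquareE latL subA.
have [RB [CB [YB [eB [rB kB yB] BR BC]]]] := subsquareE latL subB.
have [RC [CC [_ [eC [rC kC _] _ _]]]] := subsquareE latL subC.
move: eC; rewrite eA eB setIX => /setX_injective[||eR eK]; rewrite ?rC ?kC //.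
rewrite -{}eR in rC; rewrite -{}eK in kC.
(* In a row common to both subsquares, the common symbols occupy exactly the common columns. *)
have yC : #|YA :&: YB| = c.
  have /card_gt0P[i] : 0 < #|RA :&: RB| by rewrite rC.
  rewrite inE => /andP[iA iB].
  rewrite -(card_preim_inj _ (rI i)) -kC; apply: eq_card => j.
  by rewrite !inE AR // BR.
have diff (U V : {set 'I_n}) k : #|U| = k -> #|U :&: V| = c -> #|U :\: V| = k - c.
  by move=> <- <-; rewrite cardsD.
have outer (U V : {set 'I_n}) : #|U| = a -> #|V| = b -> #|U :&: V| = c ->
    #|~: (U :|: V)| + (a + b - c) = n.
  by move=> <- <- <-; rewrite -cardsU addnC cardsC card_ord.
have cb : c <= b by rewrite -rC -rB subset_leq_card ?subsetIr.
have /card_gt0P[i] : 0 < #|RA :\: RB| by rewrite (diff _ _ a) ?subn_gt0.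
rewrite inE => /andP[/negPf iB iA].
(* In the row [i] of [A] outside [B], no symbol of [YB] is in a column of [B]. So the common symbols
   lie in [CA :\: CB], and those of [YB :\: YA] lie outside both column sets. *)
have le1 : c <= a - c.
  rewrite -{1}yC -(card_preim_inj _ (rI i)) -(diff _ _ _ kA kC).
  apply/subset_leq_card/subsetP => j; rewrite !inE AR // => /andP[-> jY].
  by rewrite andbT; apply: contraTN jY => jB; rewrite BC // iB.
have le2 : b - c <= #|~: (CA :|: CB)|.
  rewrite -(diff YB YA b yB) 1?setIC // -(card_preim_inj _ (rI i)).
  apply/subset_leq_card/subsetP => j; rewrite !inE AR // => /andP[/negPf -> jY].
  by apply: contraTN jY => jB; rewrite BC // iB.
exists (a - c), (b - c), (n - (a + b - c)).
have o1 := outer _ _ kA kB kC; have o2 := outer _ _ rA rB rC.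
(* In a row outside both subsquares, a symbol of [YA :|: YB] lies either outside
   the columns of both, or in a column of one and among the symbols of the
   other; each pair (column, symbol) of the latter kind determines its row. *)
have le3 : #|~: (RA :|: RB)| * #|YA :|: YB| <=
    #|~: (RA :|: RB)| * #|~: (CA :|: CB)| +
    (#|CA :\: CB| * #|YB :\: YA| + #|CB :\: CA| * #|YA :\: YB|).
  pose cells (C S : {set 'I_n}) := [set u : 'I_n * 'I_n | (u.2 \in C) && (L u.1 u.2 \in S)].
  have cells_card (C S : {set 'I_n}) : #|cells C S| = #|C| * #|S|.
    rewrite -(@card_row_symbol _ (fun j i => L i j) C S cI).
    have sI : injective (fun u : 'I_n * 'I_n => (u.2, u.1)).
      by move=> [? ?] [? ?] [-> ->].
    rewrite -(card_imset _ sI); apply: eq_card => -[j k].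
    apply/imsetP/idP => [[[j' k']]|H]; first by rewrite !inE => H [-> ->].
    by exists (k, j); rewrite ?inE //= in H *.
  rewrite -(card_row_symbol _ _ rI) -(cardsX (~: _)) -!cells_card.
  apply: leq_trans (leq_trans (leq_card_setU _ _) (leq_add (leqnn _) (leq_card_setU _ _))).
  apply/subset_leq_card/subsetP => -[k j]; rewrite !inE /= negb_or.
  case/andP=> /andP[/negPf kRA /negPf kRB].
  have nA : (j \in CA) ==> (L k j \notin YA).
    by apply/implyP => jA; rewrite AC // kRA.
  have nB : (j \in CB) ==> (L k j \notin YB).
    by apply/implyP => jB; rewrite BC // kRB.
  rewrite kRA kRB /=; move: nA nB.
  by case: (j \in CA); case: (j \in CB); case: (_ \in YA); case: (_ \in YB).
rewrite cardsU yA yB yC (diff _ _ _ kA kC) (diff _ _ _ yA yC) in le3.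
rewrite (diff CB CA b) 1?setIC // (diff YB YA b) 1?setIC // in le3.
have o3 : #|~: (RA :|: RB)| = n - (a + b - c) by lia.
have o4 : #|~: (CA :|: CB)| = n - (a + b - c) by lia.
rewrite o3 o4 in le3; rewrite o4 in le2.
split=> //; first split; try lia.
have -> : c + (a - c) + (b - c) = a + b - c by lia.
by move: le3; rewrite (mulnC (b - c)) => le3; lia.
Qed.

End Necessity.

(** * Construction from prescribed class counts *)

Section Sufficiency.
Local Open Scope nat_scope.

Lemma card_ord_interval (n lo hi : nat) :
  hi <= n -> #|[pred i : 'I_n | lo <= i < hi]| = hi - lo.
Proof.
move=> hin; rewrite -sum1_card -(big_mkord (fun i => lo <= i < hi) (fun=> 1)).
rewrite -[RHS]muln1 -sum_nat_const_nat [RHS](big_nat_widen _ _ _ _ _ hin) /=.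
rewrite [RHS](big_nat_widenl _ 0) //; apply: eq_bigl => i.
by rewrite andbC.
Qed.

(* A row, column or symbol [i] has class [(i \in A, i \in B)]. *)
Definition class_size (p0 p1 p2 p3 : nat) (i : bool * bool) : nat :=
  if i.1 then (if i.2 then p0 else p1) else (if i.2 then p2 else p3).

(* The counts are symmetric in rows, columns and symbols; [e] is the count for
   [cD, cD, cD], determined by the marginals. *)
Definition outline (p0 p1 p2 p3 e : nat) (i j k : bool * bool) : nat :=
  let cC := (true, true) in let cA := (true, false) in
  let cB := (false, true) in let cD := (false, false) in
  let cls u v w := perm_eq [:: i; j; k] [:: u; v; w] in
  if cls cC cC cC then p0 * p0
  else if cls cC cA cA then p0 * p1
  else if cls cC cB cB then p0 * p2
  else if cls cC cD cD then p0 * p3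
  else if cls cA cA cA then p1 * (p1 - p0)
  else if cls cB cB cB then p2 * (p2 - p0)
  else if cls cA cB cD then p1 * p2
  else if cls cA cD cD then p1 * (p3 - p2)
  else if cls cB cD cD then p2 * (p3 - p1)
  else if cls cD cD cD then e
  else 0.

(** Only [i = j = (false, false)] involves [e], and there the sum is the equation defining [e]; the
    inequalities between sizes make the other subtractions exact. *)
Lemma outline_sum (p0 p1 p2 p3 e : nat) (i j : bool * bool) :
  p0 <= p1 -> p1 <= p2 -> p2 <= p3 ->
  e + p3 * (p0 + p1 + p2) = p3 * p3 + 2 * (p1 * p2) ->
  \sum_k outline p0 p1 p2 p3 e i j k
    = class_size p0 p1 p2 p3 i * class_size p0 p1 p2 p3 j.
Proof.
move=> le01 le12 le23.
rewrite -(pair_bigA _ (fun u v => outline p0 p1 p2 p3 e i j (u, v))) /=.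
rewrite !big_bool -(subnKC le23) -(subnKC le12) -(subnKC le01).
move: (p3 - p2) (p2 - p1) (p1 - p0) => w v u eE.
by case: i j => [[] []] [[] []]; rewrite /outline /class_size /=; nia.
Qed.

Lemma outline_perm (p0 p1 p2 p3 e : nat) (i j k i' j' k' : bool * bool) :
  perm_eq [:: i; j; k] [:: i'; j'; k'] ->
  outline p0 p1 p2 p3 e i j k = outline p0 p1 p2 p3 e i' j' k'.
Proof. by move=> /permPl E; rewrite /outline !E. Qed.

(** The zero entries of [outline] encode the subsquares: positivity of the counts confines the
    symbols in [A] and in [B]. *)
Lemma outline_closed (p0 p1 p2 p3 e : nat) (i j k : bool * bool) :
  0 < outline p0 p1 p2 p3 e i j k ->
  (i.1 -> j.1 -> k.1) /\ (i.2 -> j.2 -> k.2).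
Proof. by case: i j k => [[] []] [[] []] [[] []]. Qed.

Lemma subsquares_exist (p0 p1 p2 p3 : nat)
    (n := p0 + p1 + p2 + p3) :
  p0 <= p1 -> p1 <= p2 -> p2 <= p3 ->
  p3 * (p0 + p1 + p2) <= p3 * p3 + 2 * (p1 * p2) ->
  exists (L : 'M['I_n]_n) (A B : {set 'I_n * 'I_n}),
    [/\ latin_square L, subsquare L (p0 + p1) A, subsquare L (p0 + p2) B
      & subsquare L p0 (A :&: B)].
Proof.
move=> le01 le12 le23 le3.
pose e := p3 * p3 + 2 * (p1 * p2) - p3 * (p0 + p1 + p2).
have eE : e + p3 * (p0 + p1 + p2) = p3 * p3 + 2 * (p1 * p2) by rewrite subnK.
(* [A] and [B] become two intervals overlapping in [p0] indices, so each class is an interval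
   too. *)
pose t (i : 'I_n) := (i < p0 + p1, p1 <= i < p0 + p1 + p2).
have tE k : #|[pred i | t i == k]| = class_size p0 p1 p2 p3 k.
  have [lo [hi [hin <- E]]] : exists lo hi, [/\ hi <= n,
      hi - lo = class_size p0 p1 p2 p3 k
      & forall i : 'I_n, (t i == k) = (lo <= i < hi)].
    case: k => [[] []];
      [exists p1, (p0 + p1)|exists 0, p1|exists (p0 + p1), (p0 + p1 + p2)|
       exists (p0 + p1 + p2), n]; rewrite /class_size /=;
      split; try (rewrite /n; lia);
      move=> i; rewrite /t xpair_eqE; have := ltn_ord i; rewrite {2}/n;
      move: (nat_of_ord i) => m; lia.
  by rewrite -(card_ord_interval lo hin); apply: eq_card => i; rewrite !inE E.
have sumE := outline_sum _ _ le01 le12 le23 eE.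
have [|||L [rI cI Lt]] := @amalgamation _ _ t (outline p0 p1 p2 p3 e).
- by move=> i j; rewrite sumE !tE.
- move=> i k; rewrite !tE -sumE; apply: eq_bigr => j _.
  by apply: outline_perm; rewrite perm_cons (perm_catC [:: j] [:: k]).
- move=> j k; rewrite !tE -sumE; apply: eq_bigr => i _.
  by apply: outline_perm; rewrite (perm_catC [:: i] [:: j; k]).
(* Each of these sets serves at once as rows, columns and symbols of its subsquare. *)
pose A := [set i | (t i).1]; pose B := [set i | (t i).2].
pose M := \matrix_(i, j) L i j : 'M['I_n]_n.
have MrI i : injective (M i) by move=> j j'; rewrite !mxE => /rI.
have McI j : injective (M^~ j) by move=> i i'; rewrite !mxE => /cI.
have kA : #|A| = p0 + p1.
  rewrite -[RHS]subn0 -(@card_ord_interval n 0) ?/n; last lia.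
  by apply: eq_card => i; rewrite !inE.
have kB : #|B| = p0 + p2.
  have -> : p0 + p2 = p0 + p1 + p2 - p1 by lia.
  rewrite -(@card_ord_interval n) ?/n; last lia.
  by apply: eq_card => i; rewrite !inE.
have kAB : #|A :&: B| = p0.
  rewrite -[RHS](addnK p1) -(@card_ord_interval n) ?/n; last lia.
  apply: eq_card => i; rewrite !inE /=.
  by move: (nat_of_ord i) => m; lia.
have LA i j : i \in A -> j \in A -> M i j \in A.
  by rewrite !inE mxE; have [+ _] := outline_closed (Lt i j); apply.
have LB i j : i \in B -> j \in B -> M i j \in B.
  by rewrite !inE mxE; have [_] := outline_closed (Lt i j); apply.
exists M, (setX A A), (setX B B); rewrite setIX; split.
- by apply: (@latin_squareI n _ _ setT) => //; rewrite cardsT card_ord.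
- exact: (@subsquareI _ _ _ _ _ A).
- exact: (@subsquareI _ _ _ _ _ B).
- apply: (@subsquareI _ _ _ _ _ (A :&: B)) => // i j.
  rewrite ![_ \in _ :&: _]inE => /andP[iA iB] /andP[jA jB].
  by rewrite LA ?LB.
Qed.

End Sufficiency.

Theorem theorem1p2 (n a b c : nat)
    (hc : (0 < c)%N) (hca : (c < a)%N) (hab : (a <= b)%N) (hbn : (b < n)%N) :
  (exists (L : 'M['I_n]_n) (A B : {set 'I_n * 'I_n}),
     [/\ latin_square L, subsquare L a A, subsquare L b B
       & subsquare L c (A :&: B)])
  <->
  [/\ n%:Z - 2 * b%:Z >= a%:Z - 2 * c%:Z,
      a%:Z - 2 * c%:Z >= 0
    & (n%:Z - 2 * a%:Z) * (n%:Z - 2 * b%:Z)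
        >= c%:Z ^+ 2 - (n%:Z - 2 * a%:Z - 2 * b%:Z + 3 * c%:Z) ^+ 2].
Proof.
split=> [[L [A [B [latL subA subB subC]]]]|[]].
  have [p1 [p2 [p3 [[-> -> ->] le1 le2 le3]]]] :=
    subsquares_bounds hc hca latL subA subB subC.
  (* In class sizes, the first two inequalities are [p2 <= p3] and [c <= p1], and the sides of the
     third differ by [2 * (p3 * p3 + 2 * (p1 * p2) - p3 * (c + p1 + p2))]. *)
  by rewrite !expr2; split; [lia|lia|nia].
have [p1 aE] : exists p1, a = (c + p1)%N by exists (a - c)%N; lia.
have [p2 bE] : exists p2, b = (c + p2)%N by exists (b - c)%N; lia.
move=> le1 le2.
(* The first inequality gives [n >= a + 2b - 2c], which is at least [a + b - c] as [c <= b]. *)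
have [p3 nE] : exists p3, n = (c + p1 + p2 + p3)%N.
  by exists (n - (c + p1 + p2))%N; lia.
move: hab le1 le2; rewrite aE bE nE !expr2 => le0 le1 le2 le3.
by apply: subsquares_exist; [lia|lia|lia|nia].
Qed.
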